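(* Let $(U_1,\dots,U_k)$ be a set of timed automaton templates with conjunctive guards. Let $\phi=\bigwedge_{i_{l_1},\dots,i_{l_h}} Q\,\Phi(i_{l_1},\dots,i_{l_h})$, where $Q\in\{A,A_{\mathit{inf}},A_{\mathit{fin}},E,E_{\mathit{inf}},E_{\mathit{fin}}\}$, $\{l_1,\dots,l_h\}\subseteq[1,k]$, and $\Phi$ is a path formula built from atomic propositions $p(l_r,i_{l_r})$ using only $\wedge$, $\neg$ and $\mathcal{U}_{\sim q}$ (an IMTL path formula). Then $$\forall (n_1,\dots,n_k)\,.\,(U_1,\dots,U_k)^{(n_1,\dots,n_k)}\models\phi \quad\text{iff}\quad \forall (d_1,\dots,d_k)\preceq(c_1,\dots,c_k)\,.\,(U_1,\dots,U_k)^{(d_1,\dots,d_k)}\models\phi,$$ where $\preceq$ is the componentwise order and the cutoff $(c_1,\dots,c_k)$ is: (a) if $Q\in\{A_{\mathit{inf}},E_{\mathit{inf}}\}$: $c_l=2$ for $l\in\{l_1,\dots,l_h\}$ and $c_l=1$ otherwise; (b) if $Q\in\{A_{\mathit{fin}},E_{\mathit{fin}}\}$: $c_l=1$ for every $l$; (c) if $Q\in\{A,E\}$: $c_l=2|U_l|+1$ for $l\in\{l_1,\dots,l_h\}$ and $c_l=2|U_l|$ otherwise.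
   Context: Temporal constraints: for a finite set $C$ of clocks, $TC(C)$ is generated by $\top$, $\neg$, $\vee$, $x\sim y$ and $x\sim q$ with $x,y\in C$, $q\in\mathbb{Q}^{\geq0}$, $\sim\in\{<,\le,>,\ge,=\}$. A timed automaton (TA) template is $U_l=\langle S_l,\hat s_l,C_l,\Gamma_l,\tau_l,I_l\rangle$ with finite state set $S_l$, initial state $\hat s_l$, finite clock set $C_l$, finite set $\Gamma_l$ of Boolean guards over states, transitions $\tau_l\subseteq S_l\times TC(C_l)\times 2^{C_l}\times\Gamma_l\times S_l$, and invariants $I_l:S_l\to TC(C_l)$ with $I_l(\hat s_l)=\top$; $|U_l|:=|S_l|$. For natural numbers $n_1,\dots,n_k$, the network $(U_1,\dots,U_k)^{(n_1,\dots,n_k)}$ is the asynchronous parallel composition of instances $U_l^i$ ($l\in[1,k]$, $i\in[1,n_l]$), each a disjoint copy of $U_l$. Conjunctive guards: every guard of a transition of instance $U_l^i$ is a conjunction, over every other instance $U_h^j$ ($(h,j)\neq(l,i)$), of a disjunction $\hat s_h(j)\vee s^1(j)\vee\dots\vee s^q(j)$ of propositions ''instance $U_h^j$ is in state $s$'', where the initial state $\hat s_h(j)$ always appears. A configuration gives each instance $U_l^i$ a state in $S_l$ and a clock valuation $C_l\to\mathbb{R}^{\ge0}$ satisfying the invariant of that state; the initial configuration has all instances in their initial states with all clocks $0$. Transitions: a delay by $d\in\mathbb{R}^{\ge0}$ keeps all states, increases all clocks of all instances by $d$, and requires all invariants to hold at all intermediate times; a discrete step lets a single instance $U_l^i$ in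 state $s$ take $(s,g,r,\gamma,t)\in\tau_l$ if its clocks satisfy $g$ and the global state vector satisfies $\gamma$, moving to $t$, resetting the clocks in $r$ to $0$, provided the new valuation satisfies $I_l(t)$; all other instances are unchanged (interleaving semantics). A timed computation is a finite or infinite sequence $(\mathfrak c_0,t_0)(\mathfrak c_1,t_1)\dots$ from the initial configuration with $t_0=0$, each step either a delay $d>0$ with $t_{v+1}=t_v+d$ or a discrete step with $t_{v+1}=t_v$. It is infinite, deadlocked (maximal finite: it ends in a configuration where all discrete transitions are disabled), or finite (any finite one). Each timed computation induces a continuous-time path (s-path) $\rho(t)=(\text{states of }\mathfrak c_v,\ \text{clocks of }\mathfrak c_v+(t-t_v))$ for $t\in[t_v,t_{v+1})$, of the same kind (infinite/deadlocked/finite). Logic: atomic propositions $p(l,i)$ with $p\in S_l$ hold iff instance $U_l^i$ is in state $p$; $\bigwedge_{i_l}\phi(i_l)$ holds iff $\phi(i_l)$ holds for all $i_l\in[1,n_l]$ (a multi-index conjunction ranges over all index tuples); $A\Phi$ (resp. $A_{\mathit{inf}}\Phi$, $A_{\mathit{fin}}\Phi$) holds at a configuration iff every s-path from it that is infinite or deadlocked (resp. infinite, resp. finite) satisfies $\Phi$; $E_x=\neg A_x\neg$; a state formula holds on a path iff it holds at time $0$; $\rho\models\Phi_1\mathcal{U}_{\sim q}\Phi_2$ iff for some $t'\sim q$ the suffix from $t'$ satisfies $\Phi_2$ and the suffix from every $t\in[0,t')$ satisfies $\Phi_1$. A network satisfies $\phi$ iff its initial configuration does. *)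

(* Defs.v *)
From HB Require Import structures.
From mathcomp Require Import all_boot all_order all_algebra.
From mathcomp Require Import reals.

Set Implicit Arguments.
Unset Strict Implicit.
Unset Printing Implicit Defensive.
Import Order.TTheory GRing.Theory Num.Theory.
Local Open Scope ring_scope.

Definition nnrat := {q : rat | 0 <= q}.

Inductive comparison := Lt | Le | Gt | Ge | Eq.

Definition compare (R : realType) (o : comparison) (x y : R) : bool :=
  match o with
  | Lt => x < y
  | Le => x <= y
  | Gt => y < x
  | Ge => y <= x
  | Eq => x == y
  end.

(* Temporal constraints TC(C). *)
Inductive tc (C : finType) :=
  | TTop
  | TNot of tc C
  | TOr of tc C & tc C
  | TClock of C & comparison & C
  | TConst of C & comparison & nnrat.
Arguments TTop {C}.

Fixpoint tc_sat (R : realType) (C : finType) (u : C -> R) (g : tc C) : Prop :=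
  match g with
  | TTop => True
  | TNot g1 => ~ tc_sat u g1
  | TOr g1 g2 => tc_sat u g1 \/ tc_sat u g2
  | TClock x o y => compare o (u x) (u y)
  | TConst x o q => compare o (u x) (ratr (val q))
  end.

(* Templates are indexed by 'I_k and S h is the state set of template h.
   A conjunctive guard G is given by the sets G h = {s^1, ..., s^q} of disjuncts
   listed for an instance of template h besides its initial state, which the
   semantics (guard_holds) always adds. *)
Definition guard (k : nat) (S : 'I_k -> finType) :=
  {dffun forall h : 'I_k, {set S h}}.

Record template (k : nat) (S : 'I_k -> finType) (l : 'I_k) := Template {
  initial : S l;
  clocks : finType;
  guards : {set guard S};
  trans : S l -> tc clocks -> {set clocks} -> guard S -> S l -> Prop;
  inv : S l -> tc clocks;
  trans_guards : forall s g r G t, trans s g r G t -> G \in guards;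
  inv_initial : inv initial = TTop
}.

Definition template_size (k : nat) (S : 'I_k -> finType) (l : 'I_k)
  (_ : template S l) : nat := #|S l|.

Section Network.
Variables (R : realType) (k : nat) (S : 'I_k -> finType).
Variables (U : forall l, template S l) (n : 'I_k -> nat).

Definition instance := {l : 'I_k & 'I_(n l)}.

Record config := Config {
  state : forall a : instance, S (tag a);
  clock : forall a : instance, clocks (U (tag a)) -> R
}.

Definition inv_holds (c : config) (a : instance) : Prop :=
  tc_sat (@clock c a) (inv (U (tag a)) (state c a)).

Definition valid_config (c : config) : Prop :=
  (forall a x, 0 <= @clock c a x) /\ (forall a, inv_holds c a).

Definition init_config : config :=
  Config (fun a => initial (U (tag a))) (fun _ _ => 0).

Definition delay (c : config) (d : R) : config :=
  Config (state c) (fun a x => @clock c a x + d).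

Definition delay_step (c : config) (d : R) (c' : config) : Prop :=
  (forall d', 0 <= d' <= d -> forall a, inv_holds (delay c d') a) /\
  c' = delay c d.

Definition guard_holds (c : config) (a : instance) (G : guard S) : Prop :=
  forall b : instance, b != a ->
    state c b = initial (U (tag b)) \/ state c b \in G (tag b).

Definition discrete_step (c : config) (a : instance) (c' : config) : Prop :=
  (exists g r G,
    [/\ trans (state c a) g r G (state c' a),
        tc_sat (@clock c a) g,
        guard_holds c a G &
        forall x, @clock c' a x = if x \in r then 0 else @clock c a x]) /\
  inv_holds c' a /\
  forall b, b != a ->
    state c' b = state c b /\ forall x, @clock c' b x = @clock c b x.

(* len = Some m: the computation is (cfg 0, time 0) ... (cfg m, time m);
   len = None: it is infinite.  Entries beyond m are irrelevant. *)
Record computation := Computation {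
  len : option nat;
  cfg : nat -> config;
  time : nat -> R
}.

Definition has_step (x : computation) (v : nat) : bool :=
  if len x is Some m then (v < m)%N else true.

Definition timed_computation (c0 : config) (x : computation) : Prop :=
  [/\ cfg x 0%N = c0, time x 0%N = 0, valid_config c0 &
   forall v, has_step x v ->
     valid_config (cfg x v.+1) /\
     ((exists2 d, 0 < d &
         delay_step (cfg x v) d (cfg x v.+1) /\ time x v.+1 = time x v + d) \/
      (exists2 a, discrete_step (cfg x v) a (cfg x v.+1) &
         time x v.+1 = time x v))].

Definition infinite (x : computation) : Prop := len x = None.

Definition deadlocked (x : computation) : Prop :=
  exists2 m, len x = Some m & forall a c', ~ discrete_step (cfg x m) a c'.

Definition finite (x : computation) : Prop := exists m, len x = Some m.

(* A path is a partial function of time, represented by its graph. *)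
Definition path := R -> config -> Prop.

(* Only the intervals [t_v, t_(v+1)) between two consecutive entries carry
   values: a finite computation ending at time T induces a path on [0, T). *)
Definition spath (x : computation) : path := fun s c =>
  exists2 v, has_step x v &
    time x v <= s < time x v.+1 /\ c = delay (cfg x v) (s - time x v).

Definition defined_at (rho : path) (s : R) : Prop := exists c, rho s c.

Definition suffix (rho : path) (s : R) : path := fun s' => rho (s + s').

End Network.

(* Path formulas over the indices i_(l_1), ..., i_(l_h), where ls r = l_r;
   Atom r p is the proposition p(l_r, i_(l_r)). *)
Inductive imtl (k : nat) (S : 'I_k -> finType) (h : nat) (ls : 'I_h -> 'I_k) :=
  | Atom (r : 'I_h) of S (ls r)
  | And of imtl S ls & imtl S ls
  | Not of imtl S ls
  | Until of comparison & nnrat & imtl S ls & imtl S ls.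

Inductive quantifier := A | A_inf | A_fin | E | E_inf | E_fin.

Section Satisfaction.
Variables (R : realType) (k : nat) (S : 'I_k -> finType).
Variables (U : forall l, template S l) (n : 'I_k -> nat).
Variables (h : nat) (ls : 'I_h -> 'I_k).

Definition index := forall r : 'I_h, 'I_(n (ls r)).

Fixpoint path_sat (i : index) (rho : path R U n) (Phi : imtl S ls) : Prop :=
  match Phi with
  | Atom r p =>
      exists2 c, rho 0 c & state c (existT (fun l => 'I_(n l)) (ls r) (i r)) = p
  | And Phi1 Phi2 => path_sat i rho Phi1 /\ path_sat i rho Phi2
  | Not Phi1 => ~ path_sat i rho Phi1
  | Until o q Phi1 Phi2 =>
      exists t : R,
        [/\ 0 <= t /\ compare o t (ratr (val q)),
            defined_at rho t,
            path_sat i (suffix rho t) Phi2 &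
            forall s, 0 <= s < t -> path_sat i (suffix rho s) Phi1]
  end.

(* A computation in which no time elapses (a finite or infinite run of discrete
   steps at time 0) induces the empty function, on which "holds at time 0" has
   no meaning; it contributes no path. *)
Definition all_paths (kind : computation R U n -> Prop) (c : config R U n)
    (i : index) (Phi : imtl S ls) : Prop :=
  forall x, timed_computation c x -> kind x -> defined_at (spath x) 0 ->
    path_sat i (spath x) Phi.

Definition maximal (x : computation R U n) : Prop := infinite x \/ deadlocked x.

Definition state_sat (Q : quantifier) (c : config R U n) (i : index)
    (Phi : imtl S ls) : Prop :=
  match Q with
  | A => all_paths maximal c i Phi
  | A_inf => all_paths (@infinite R k S U n) c i Phi
  | A_fin => all_paths (@finite R k S U n) c i Phi
  | E => ~ all_paths maximal c i (Not Phi)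
  | E_inf => ~ all_paths (@infinite R k S U n) c i (Not Phi)
  | E_fin => ~ all_paths (@finite R k S U n) c i (Not Phi)
  end.

Definition network_models (Q : quantifier) (Phi : imtl S ls) : Prop :=
  forall i : index, state_sat Q (init_config R U n) i Phi.

End Satisfaction.

Definition cutoff (k : nat) (S : 'I_k -> finType) (U : forall l, template S l)
    (h : nat) (ls : 'I_h -> 'I_k) (Q : quantifier) (l : 'I_k) : nat :=
  match Q with
  | A_inf | E_inf => if l \in codom ls then 2%N else 1%N
  | A_fin | E_fin => 1%N
  | A | E => if l \in codom ls then (2 * template_size (U l) + 1)%N
             else (2 * template_size (U l))%N
  end.

(* Main.v *)
(* Guards are conjunctive and admit the initial state, so they survive both the
   removal of instances and the addition of instances that idle in their initial
   states, where the invariant is trivial. Removing instances can turn an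
   infinite run into a finite one, but not if some label (delay, or move of a
   given instance) that occurs infinitely often is retained: one instance beyond
   those named by the indices suffices. Conversely a finite run is turned into a
   maximal one by taking discrete steps as long as possible, which takes no time
   and leaves the s-path unchanged. Hence the s-paths of maximal runs are those
   of finite and of infinite runs, and the cutoffs of (c) are not tight. *)
Require Import Defs.
From mathcomp Require Import all_boot all_order all_algebra.
From mathcomp Require Import boolp reals.
From mathcomp Require Import zify.

(** * Labelled steps and basic facts on computations *)

Section Networks.
Set Implicit Arguments.
Unset Strict Implicit.
Import Order.TTheory GRing.Theory Num.Theory.
Local Open Scope ring_scope.

Variables (R : realType) (k : nat) (S : 'I_k -> finType).
Variable U : forall l, template S l.

Local Notation clk c a := (@clock _ _ _ _ _ c a).
Local Notation inst n l j := (existT (fun l0 => 'I_(n l0)) l j : instance n).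
Local Notation config := (config R U).
Local Notation computation := (computation R U).

(** The label tells who acts: [Some a] for a move of [a], [None] for a delay. Labels form a finite
    type, which makes the pigeonhole argument for infinite runs possible. *)
Definition step_by n (o : option (instance n)) (c : config n) (t : R)
    (c' : config n) (t' : R) : Prop :=
  if o is Some a then discrete_step c a c' /\ t' = t
  else exists2 d, 0 < d & delay_step c d c' /\ t' = t + d.

Lemma timed_computationP n (c0 : config n) (x : computation n) :
  timed_computation c0 x <->
  [/\ cfg x 0%N = c0, time x 0%N = 0, valid_config c0 &
   forall v, has_step x v -> valid_config (cfg x v.+1) /\
     exists o, step_by o (cfg x v) (time x v) (cfg x v.+1) (time x v.+1)].
Proof.
split=> -[? ? ? xP]; split=> // v /xP[? stepv]; split=> //.
  by case: stepv => [?|[a ? ?]]; [exists None | exists (Some a)].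
by case: stepv => -[a [? ?]|?]; [right; exists a | left].
Qed.

Lemma config_eq n (c c' : config n) :
  (forall a, state c a = state c' a) -> (forall a, clk c a =1 clk c' a) ->
  c = c'.
Proof.
case: c c' => [s u] [s' u'] /= es eu.
have -> : s = s' by apply: functional_extensionality_dep.
by congr Config; apply: functional_extensionality_dep => a; apply: funext.
Qed.

Lemma inv_holds_eq n (c c' : config n) a :
  state c' a = state c a -> clk c' a =1 clk c a ->
  inv_holds c a -> inv_holds c' a.
Proof. by rewrite /inv_holds => -> /funext ->. Qed.

Lemma discrete_step_valid n (c c' : config n) a :
  discrete_step c a c' -> valid_config c -> valid_config c'.
Proof.
move=> [[g [r [G [_ _ _ ua]]]] [inva others]] [upos cinv].
split=> b; have [->|/others[sb ub]] := eqVneq b a => //.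
- by move=> z; rewrite ua; case: ifP.
- by move=> z; rewrite ub.
- exact: inv_holds_eq (cinv b).
Qed.

Lemma init_config_valid n : valid_config (init_config R U n).
Proof. by split=> // a; rewrite /inv_holds inv_initial. Qed.

Lemma step_by_time_le n o (c c' : config n) t t' : step_by o c t c' t' -> t <= t'.
Proof.
by case: o => [a [_ ->]|[d dpos [_ ->]]] //=; rewrite lerDl ltW.
Qed.

Lemma has_step_le n (x : computation n) v w :
  (v <= w)%N -> has_step x w -> has_step x v.
Proof. by rewrite /has_step; case: len => // m; apply: leq_ltn_trans. Qed.

(** The condition on [v] says that entry [v] is the initial one or the target of a step; entries
    past the end are arbitrary. *)
Lemma timed_computation_reach n (c0 : config n) x v :
  timed_computation c0 x ->
  ((if v is w.+1 then has_step x w else true) : bool) ->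
  valid_config (cfg x v) /\ 0 <= time x v.
Proof.
move=> /timed_computationP[x0 t0 vc0 xP].
elim: v => [_|v IHv hv]; first by rewrite x0 t0.
have [validS [o /step_by_time_le le_t]] := xP v hv.
split=> //; apply: le_trans le_t; apply: (IHv _).2.
by case: v hv {IHv validS xP} => // v; apply: has_step_le.
Qed.

(** Indices outside [P] change neither configuration nor time, so deleting them leaves a
    computation. The path is unaffected, since a stutter spans an empty time interval. *)
Lemma destutter n (c : nat -> config n) (t : nat -> R) (P : pred nat) :
  (forall v, valid_config (c v)) -> t 0%N = 0 ->
  (forall v, P v -> exists o, step_by o (c v) (t v) (c v.+1) (t v.+1)) ->
  (forall v, ~~ P v -> c v.+1 = c v /\ t v.+1 = t v) ->
  exists y, [/\ timed_computation (c 0%N) y,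
    forall s e, spath y s e <->
      exists v, t v <= s < t v.+1 /\ e = delay (c v) (s - t v),
    (forall m, exists2 v, (m <= v)%N & P v) -> infinite y &
    forall m, (forall v, (m <= v)%N -> ~~ P v) -> finite y].
Proof.
move=> cvalid t0 proper stutter.
(* [g v] is the position of entry [v] once stutters are deleted. *)
pose g v := count P (iota 0 v).
have gS v : g v.+1 = (g v + P v)%N by rewrite /g -addn1 iotaD count_cat /= addn0.
have g_mono v w : (v <= w)%N -> (g v <= g w)%N.
  move=> /subnKC <-; elim: (w - v)%N => [|i IHi]; first by rewrite addn0.
  by rewrite addnS gS (leq_trans IHi) // leq_addr.
(* Equal counts mean that only stutters lie in between, so [c] and [t] factor through [g]. *)
have g_shift v i : g (v + i)%N = g v -> c (v + i)%N = c v /\ t (v + i)%N = t v.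
  elim: i => [|i IHi]; first by rewrite addn0.
  rewrite addnS gS => gE.
  have NP : ~~ P (v + i)%N.
    by apply/negP => Pv; have := g_mono v (v + i)%N (leq_addr _ _);
      rewrite -gE Pv addn1 ltnn.
  have [-> ->] := stutter _ NP; apply: IHi.
  by rewrite -gE (negbTE NP) addn0.
have g_fiber v w : g v = g w -> c v = c w /\ t v = t w.
  by case/orP: (leq_total v w) => /subnKC <- gE;
    [have [] := g_shift v (w - v)%N (esym gE) | exact: g_shift].
have g_onto j w : (j < g w)%N -> exists2 v, P v & g v = j.
  elim: w => [//|w IHw]; rewrite gS; case Pw: (P w); last by rewrite addn0.
  rewrite addn1 ltnS leq_eqVlt => /orP[/eqP ->|//]; by exists w.
(* [f] is a section of [g] on its range; the new computation reads [c] and [t] along [f]. *)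
have /choice[f fP] j : exists v, (exists w, g w = j) -> g v = j.
  by have [[w gw]|nw] := EM (exists w, g w = j); [exists w | exists 0%N].
have cfg_f v : c (f (g v)) = c v /\ t (f (g v)) = t v.
  by apply: g_fiber; apply: fP; exists v.
have [L [Lstep Lonto Linf Lfin]] : exists L : option nat,
    let y := Computation L (c \o f) (t \o f) in
    [/\ forall v, P v -> has_step y (g v),
        forall j, has_step y j -> exists2 v, P v & g v = j,
        (forall m, exists2 v, (m <= v)%N & P v) -> infinite y &
        forall m, (forall v, (m <= v)%N -> ~~ P v) -> finite y].
  (* If all indices from [m] on are stutters, the new length is the number [g m] of proper steps;
     otherwise the new computation is infinite. *)
  have [[m mP]|infP] := EM (exists m, forall v, (m <= v)%N -> ~~ P v).
    exists (Some (g m)); split=> [v Pv|j|infP|_ _].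
    - rewrite /has_step /=; apply: (@leq_trans (g v.+1)); first by rewrite gS Pv addn1.
      by apply: g_mono; rewrite ltnNge; apply/negP => /mP; rewrite Pv.
    - exact: g_onto.
    - by have [v /mP/negP] := infP m.
    - by exists (g m).
  have P_unbounded m : exists2 v, (m <= v)%N & P v.
    apply: contrapT => nv; apply: infP; exists m => v mv; apply/negP => Pv.
    by apply: nv; exists v.
  exists None; split=> // [j _|m mP]; last by case: infP; exists m.
  suff [w] : exists w, (j < g w)%N by apply: g_onto.
  elim: j => [|j [w jw]].
    by have [v _ Pv] := P_unbounded 0%N; exists v.+1; rewrite gS Pv addn1.
  have [v wv Pv] := P_unbounded w; exists v.+1; rewrite gS Pv addn1 ltnS.
  exact: leq_trans jw (g_mono _ _ wv).
exists (Computation L (c \o f) (t \o f)); split=> //.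
  have [c0E t0E] := cfg_f 0%N.
  apply/timed_computationP; split=> //=; first by rewrite t0E.
  move=> j /Lonto[v Pv <-].
  have [-> ->] := cfg_f v; have := cfg_f v.+1; rewrite gS Pv addn1 => -[-> ->].
  by split; [exact: cvalid | exact: proper].
move=> s e; split=> [[j /Lonto[v Pv <-] /=]|[v [ts ->]]].
  have [-> ->] := cfg_f v; have := cfg_f v.+1; rewrite gS Pv addn1 => -[_ ->].
  by exists v.
have Pv : P v.
  apply/negPn/negP => /stutter[_ tE]; move: ts.
  by rewrite tE => /andP[/le_lt_trans h /h]; rewrite ltxx.
exists (g v) => /=; first exact: Lstep.
have [-> ->] := cfg_f v; have := cfg_f v.+1; rewrite gS Pv addn1 => -[_ ->].
by [].
Qed.

(** Chosen discrete steps are appended until a deadlock is met, or forever. They all happen at the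
    final time of [x], hence add nothing to the path. *)
Lemma finite_extends_to_maximal n (c0 : config n) x :
  timed_computation c0 x -> finite x ->
  exists y, [/\ timed_computation c0 y, maximal y & spath y = spath x].
Proof.
move=> xC [m lenx].
have /choice[nxt nxtP] (c : config n) : exists c',
    (exists a c'', discrete_step c a c'') -> exists a, discrete_step c a c'.
  have [[a [c' cc']]|nc] := EM (exists a c'', discrete_step c a c'').
    by exists c' => _; exists a.
  by exists c.
pose z j := iter j nxt (cfg x m).
pose dead j := forall a c', ~ discrete_step (z j) a c'.
have live j : ~ dead j -> exists a, discrete_step (z j) a (z j.+1).
  move=> ndead; apply: nxtP; apply: contrapT => none; apply: ndead => a c' cc'.
  by apply: none; exists a, c'.
pose C v := if (v <= m)%N then cfg x v else z (v - m)%N.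
pose T v := time x (minn v m).
have CD j : C (m + j)%N = z j.
  rewrite /C addKn; case: ifP => //; rewrite -[X in (_ <= X)%N]addn0 leq_add2l leqn0.
  by move/eqP ->; rewrite addn0.
have TD j : T (m + j)%N = time x m by rewrite /T (minn_idPr _) ?leq_addr.
have Clt v : (v <= m)%N -> C v = cfg x v by rewrite /C => ->.
have Tlt v : (v <= m)%N -> T v = time x v by rewrite /T => /minn_idPl ->.
have [x0 t0 vc0 xP] := (timed_computationP c0 x).1 xC.
have xstep v : has_step x v = (v < m)%N by rewrite /has_step lenx.
have z0valid : valid_config (z 0%N).
  apply: (timed_computation_reach xC _).1 => /=.
  by case: (m) xstep => // m' ->.
(* Both outcomes use the same glued sequences [C] and [T]; only the length [L] differs. It must
   cover [x] and must not require a step out of a dead configuration. *)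
have compat (L : option nat) (y := Computation L C T) :
    (forall v, (v < m)%N -> has_step y v) ->
    (forall j, has_step y (m + j)%N -> ~ dead j) ->
    timed_computation c0 y /\ spath y = spath x.
  move=> long alive; split.
    apply/timed_computationP; split; rewrite /= ?Clt ?Tlt //.
    move=> v hv; have [vm|] := ltnP v m.
      by rewrite !Clt ?Tlt ?(ltnW vm) //; apply: xP; rewrite xstep.
    move=> /subnKC vE; move: hv; rewrite -vE -addnS !CD !TD => hv.
    set j := (v - m)%N in hv *.
    have zvalid i : (i <= j)%N -> valid_config (z i.+1) /\
        exists a, discrete_step (z i) a (z i.+1).
      elim: i => [|i IHi] ij.
        have [a st] := live 0%N (alive 0%N (has_step_le (leq_add (leqnn m) ij) hv)).
        by split; [exact: discrete_step_valid st _ | exists a].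
      have [a st] := live i.+1 (alive i.+1 (has_step_le (leq_add (leqnn m) ij) hv)).
      by split; [exact: discrete_step_valid st (IHi (ltnW ij)).1 | exists a].
    have [? [a st]] := zvalid j (leqnn j).
    by split=> //; exists (Some a).
  apply: funext => s; apply: funext => c; apply: propext.
  split=> -[v hv [ts ->]].
    have vm : (v < m)%N.
      rewrite ltnNge; apply/negP => /subnKC vE; move: ts.
      by rewrite /= -vE -addnS !TD => /andP[/le_lt_trans h /h]; rewrite ltxx.
    exists v; first by rewrite xstep.
    by move: ts; rewrite /= Clt ?Tlt ?(ltnW vm).
  rewrite xstep in hv; exists v; first exact: long.
  by rewrite /= Clt ?Tlt ?(ltnW hv).
have [[j deadj]|nodead] := EM (exists j, dead j).
  have ex_dead : exists j, `[< dead j >] by exists j; apply/asboolP.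
  (* Stopping at the first dead configuration guarantees that every earlier one has a successor. *)
  case: (ex_minnP ex_dead) => {deadj}j /asboolP deadj jmin.
  have [||yC ypath] := compat (Some (m + j)%N).
  - by move=> v vm; apply: leq_trans vm (leq_addr _ _).
  - move=> i; rewrite /has_step /= ltn_add2l => ij /asboolP/jmin.
    by rewrite leqNgt ij.
  exists (Computation (Some (m + j)%N) C T); split=> //.
  by right; exists (m + j)%N; rewrite //= CD.
have [//|j _ deadj|yC ypath] := compat None; first by apply: nodead; exists j.
by exists (Computation None C T); split=> //; left.
Qed.

(** * Projection and lifting along an embedding of networks *)

Section Embedding.
Variables (d n : 'I_k -> nat) (e : forall l, 'I_(d l) -> 'I_(n l)).
Hypothesis e_inj : forall l, injective (@e l).

Definition emb (a : instance d) : instance n :=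
  inst n (tag a) (e (tagged a)).

Lemma emb_inj : injective emb.
Proof.
case=> l j [l' j'] /= eq_emb.
have eqll' : l = l' := congr1 (fun a : instance n => tag a) eq_emb.
move: j' eq_emb; rewrite -eqll' => j' /eqP.
by rewrite /emb /= eq_Tagged /= => /eqP/e_inj ->.
Qed.

Definition proj (c : config n) : config d :=
  Config (fun a => state c (emb a)) (fun a => clk c (emb a)).

Definition kept (o : option (instance n)) : bool :=
  if o is Some a then a \in codom emb else true.

Lemma proj_valid c : valid_config c -> valid_config (proj c).
Proof.
case=> upos cinv; split=> a; first exact: (upos (emb a)).
exact: (cinv (emb a)).
Qed.

(** A conjunctive guard and the invariants quantify over instances, so having fewer instances only
    weakens them. *)
Lemma proj_step o c t c' t' : kept o -> step_by o c t c' t' ->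
  exists o', step_by o' (proj c) t (proj c') t'.
Proof.
case: o => [a /codomP[b ->]|_] /=.
  move=> [[[g [r [G [tr sat guarded clkb]]]] [invb others]] ->].
  exists (Some b); split=> //; split; [exists g, r, G; split=> // | split=> //].
    by move=> b' b'b; apply: (guarded (emb b')); rewrite (inj_eq emb_inj).
  by move=> b' b'b; apply: (others (emb b')); rewrite (inj_eq emb_inj).
move=> [s spos [[inv_s ->] ->]]; exists None, s => //; split=> //; split=> //.
by move=> s' /inv_s inv_s' a; apply: (inv_s' (emb a)).
Qed.

Lemma proj_stutter o c t c' t' : ~~ kept o -> step_by o c t c' t' ->
  proj c' = proj c /\ t' = t.
Proof.
case: o => // a /codomP nota [[_ [_ others]] ->]; split=> //.
have emb_neq b : emb b != a by apply/eqP => ba; apply: nota; exists b.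
by apply: config_eq => b; have [] := others _ (emb_neq b).
Qed.

(** Moves of forgotten instances become stutters, which [destutter] deletes. An infinite run stays
    infinite provided that kept labels recur forever. *)
Lemma project_computation x (lab : nat -> option (instance n)) :
  timed_computation (init_config R U n) x ->
  (forall v, has_step x v ->
     step_by (lab v) (cfg x v) (time x v) (cfg x v.+1) (time x v.+1)) ->
  exists y, [/\ timed_computation (init_config R U d) y,
    forall s c', spath y s c' <-> exists2 c, spath x s c & c' = proj c,
    infinite x -> (forall m, exists2 v, (m <= v)%N & kept (lab v)) ->
      infinite y &
    finite x -> finite y].
Proof.
move=> xC labP.
have [x0 t0 _ xP] := (timed_computationP _ x).1 xC.
(* [destutter] wants total sequences of valid configurations. Clamping the index at the length of
   [x] replaces the arbitrary tail by stutters. *)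
pose b v := if len x is Some m then minn v m else v.
have bl v : has_step x v -> b v = v /\ b v.+1 = v.+1.
  by rewrite /has_step /b; case: len => // m vm; rewrite !(minn_idPl _) // ltnW.
have bg v : ~~ has_step x v -> b v.+1 = b v.
  rewrite /has_step /b; case: len => // m; rewrite -leqNgt => mv.
  by rewrite !(minn_idPr _) // ltnW.
have b_reach v : (if b v is w.+1 then has_step x w else true) : bool.
  rewrite /has_step /b; case: len => [m|]; last by case: v.
  by case E: (minn v m) => [//|w]; rewrite -ltnS -E ltnS geq_minr.
have [||||y []] := @destutter _ (fun v => proj (cfg x (b v)))
  (fun v => time x (b v)) (fun v => has_step x v && kept (lab v)).
- by move=> v; apply/proj_valid/(timed_computation_reach xC (b_reach v)).1.
- by rewrite /b; case: len => // m; rewrite min0n.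
- move=> v /andP[hv kv]; have [-> ->] := bl v hv.
  by apply: proj_step kv _; apply: labP.
- move=> v; case: (boolP (has_step x v)) => /= hv; last by rewrite bg.
  have [-> ->] := bl v hv => kv; exact: proj_stutter kv (labP v hv).
rewrite (_ : b 0%N = 0%N) ?x0; last by rewrite /b; case: len => // m; rewrite min0n.
move=> yC ypath yinf yfin; exists y; split=> //.
- move=> s c'; rewrite ypath; split=> [[v [ts ->]]|[c [v hv [ts ->]] ->]].
    have hv : has_step x v.
      apply: contraT => /bg bv; move: ts.
      by rewrite bv => /andP[/le_lt_trans h /h]; rewrite ltxx.
    move: ts; have [-> ->] := bl v hv => ts.
    by exists (delay (cfg x v) (s - time x v)) => //; exists v.
  by exists v; have [-> ->] := bl v hv.
- move=> xinf often; apply: yinf => m; have [v mv kv] := often m.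
  by exists v => //; rewrite kv andbT /has_step xinf.
- move=> [m lenx]; apply: (yfin m) => v mv.
  by rewrite /has_step lenx ltnNge mv.
Qed.

(** Added instances never leave their initial state and never reset a clock, so all their clocks
    show the elapsed time [t]. *)
Definition lift (c : config d) (t : R) : config n := Config
  (fun a => if [pick j | e j == tagged a] is Some j
            then state c (inst d (tag a) j)
            else initial (U (tag a)))
  (fun a => if [pick j | e j == tagged a] is Some j
            then clk c (inst d (tag a) j)
            else fun=> t).

Lemma lift_emb c t a :
  state (lift c t) (emb a) = state c a /\ clk (lift c t) (emb a) = clk c a.
Proof.
case: a => l j /=; case: pickP => [i /eqP/e_inj -> //|/(_ j)].
by rewrite eqxx.
Qed.

Lemma lift_cases (a : instance n) : (exists a', a = emb a') \/
  (forall c t, state (lift c t) a = initial (U (tag a)) /\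
               clk (lift c t) a = fun=> t).
Proof.
case: a => l i /=; case: pickP => [j /eqP <-|none]; last by right.
by left; exists (existT _ l j).
Qed.

Lemma lift_delay c t s : lift (delay c s) (t + s) = delay (lift c t) s.
Proof.
by apply: config_eq => [a|a z] /=; case: pickP.
Qed.

Lemma lift_inv c t a : inv_holds (lift c t) (emb a) <-> inv_holds c a.
Proof. by rewrite /inv_holds; have [-> ->] := lift_emb c t a. Qed.

Lemma lift_inv_all c t : (forall a, inv_holds c a) ->
  forall a, inv_holds (lift c t) a.
Proof.
move=> cinv a; have [[a' ->]|/(_ c t)[sa _]] := lift_cases a.
  exact/lift_inv.
by rewrite /inv_holds sa inv_initial.
Qed.

Lemma lift_valid c t : 0 <= t -> valid_config c -> valid_config (lift c t).
Proof.
move=> t0 [upos cinv]; split; last exact: lift_inv_all.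
move=> a; have [[a' ->]|/(_ c t)[_ ->] //] := lift_cases a.
by have [_ ->] := lift_emb c t a'.
Qed.

(** Idle instances block nothing: every guard admits the initial state, and the invariant there is
    [TTop]. *)
Lemma lift_step o c t c' t' : step_by o c t c' t' ->
  step_by (omap emb o) (lift c t) t (lift c' t') t'.
Proof.
case: o => [a|] /=; last first.
  move=> [s spos [[cinv ->] ->]]; exists s => //; split=> //.
  split; last exact: lift_delay.
  by move=> s' /cinv cinv' a; rewrite -lift_delay; apply: lift_inv_all.
move=> [[[g [r [G [tr sat guarded clka]]]] [inva others]] ->]; split=> //.
have [sa ua] := lift_emb c t a; have [sa' ua'] := lift_emb c' t a.
split; [exists g, r, G; split | split].
- by rewrite sa sa'.
- by rewrite ua.
- move=> b; have [[b' ->]|/(_ c t)[-> _]] := lift_cases b; last by left.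
  rewrite (inj_eq emb_inj) => /guarded; have [-> _] := lift_emb c t b'.
  by [].
- by move=> z; rewrite ua ua'.
- exact/lift_inv.
- move=> b; have [[b' ->]|out _] := lift_cases b.
    rewrite (inj_eq emb_inj) => /others.
    by have [-> ->] := lift_emb c t b'; have [-> ->] := lift_emb c' t b'.
  by have [-> ->] := out c t; have [-> ->] := out c' t.
Qed.

Lemma lift_init : lift (init_config R U d) 0 = init_config R U n.
Proof. by apply: config_eq => [a|a z] /=; case: pickP. Qed.

Definition lift_computation (y : computation d) : computation n :=
  Computation (len y) (fun v => lift (cfg y v) (time y v)) (time y).

Lemma lift_timed_computation y : timed_computation (init_config R U d) y ->
  timed_computation (init_config R U n) (lift_computation y).
Proof.
move=> yC; have [y0 t0 _ yP] := (timed_computationP _ y).1 yC.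
apply/timed_computationP; split=> //=; first by rewrite y0 t0 lift_init.
  exact: init_config_valid.
move=> v hv; have [validS [o st]] := yP v hv; split.
  apply: lift_valid validS; exact: (@timed_computation_reach _ _ _ v.+1 yC hv).2.
by exists (omap emb o); apply: lift_step.
Qed.

Lemma lift_spath y s c : spath (lift_computation y) s c <->
  exists2 c', spath y s c' & c = lift c' s.
Proof.
have E v : delay (lift (cfg y v) (time y v)) (s - time y v) =
           lift (delay (cfg y v) (s - time y v)) s.
  by rewrite -lift_delay (addrC (time y v)) subrK.
split=> [[v hv [ts ->]]|[c' [v hv [ts ->]] ->]].
  by exists (delay (cfg y v) (s - time y v)); [exists v | exact: E].
by exists v; rewrite //= E.
Qed.

End Embedding.

(** * Invariance of path formulas under agreement on the named instances *)

Section Formulas.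
Variables (h : nat) (ls : 'I_h -> 'I_k).

Definition same_path n d (i : Defs.index n ls) (i' : Defs.index d ls)
    (rho : Defs.path R U n) (rho' : Defs.path R U d) : Prop :=
  let agree c c' := forall r,
    state c (inst n (ls r) (i r)) =
    state c' (inst d (ls r) (i' r)) in
  forall s, (forall c, rho s c -> exists2 c', rho' s c' & agree c c') /\
            (forall c', rho' s c' -> exists2 c, rho s c & agree c c').

Lemma same_path_defined n d (i : Defs.index n ls) (i' : Defs.index d ls) rho rho' s :
  same_path i i' rho rho' -> defined_at rho s <-> defined_at rho' s.
Proof.
by move=> /(_ s)[to from]; split=> [[c /to[c' ? _]]|[c /from[c' ? _]]]; exists c'.
Qed.

(** Truth depends only on where the path is defined and on the states of the named instances. The
    induction is over all paths because [Until] passes to suffixes. *)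
Lemma same_path_sat n d (i : Defs.index n ls) (i' : Defs.index d ls) (Phi : imtl S ls)
    rho rho' : same_path i i' rho rho' ->
  path_sat i rho Phi <-> path_sat i' rho' Phi.
Proof.
elim: Phi rho rho' => [r p|P1 IH1 P2 IH2|P1 IH1|o q P1 IH1 P2 IH2] rho rho' same /=.
- have [to from] := same 0.
  by split=> -[c]; [move=> /to[c' ? agree] <- | move=> /from[c' ? agree] <-];
    exists c'; rewrite ?agree.
- by rewrite (IH1 _ _ same) (IH2 _ _ same).
- by rewrite (IH1 _ _ same).
- have same_suffix s : same_path i i' (Defs.suffix rho s) (Defs.suffix rho' s).
    by move=> s'; apply: same.
  split=> -[t [tq def sat2 sat1]]; exists t; split=> //.
  + exact/(same_path_defined t same).
  + exact/(IH2 _ _ (same_suffix t)).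
  + by move=> s /sat1/(IH1 _ _ (same_suffix s)).
  + exact/(same_path_defined t same).
  + exact/(IH2 _ _ (same_suffix t)).
  + by move=> s /sat1/(IH1 _ _ (same_suffix s)).
Qed.

(** * The subnetwork of the named instances and one optional further instance *)

Section Kept.
Variables (n : 'I_k -> nat) (i : Defs.index n ls) (o : option (instance n)).

Definition kept_set l : {set 'I_(n l)} :=
  [set j | [exists r, inst n (ls r) (i r) == inst n l j]
           || (o == Some (inst n l j))].

(** As [ls] is injective, each template carries at most one index; the label [o] contributes at most
    one more instance. *)
Lemma card_kept_set l : injective ls ->
  (#|kept_set l| <= (l \in codom ls) + (o != None))%N.
Proof.
move=> ls_inj.
have -> : kept_set l =
    [set j | [exists r, inst n (ls r) (i r) == inst n l j]]
    :|: [set j | o == Some (inst n l j)] by apply/setP => j; rewrite !inE.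
apply: leq_trans (leq_card_setU _ _) _; apply: leq_add.
  case: (boolP (l \in codom ls)) => [/codomP[r ->]|nl] /=.
    apply: leq_trans (_ : #|[set i r]| <= 1)%N; last by rewrite cards1.
    apply: subset_leq_card; apply/subsetP => j; rewrite !inE => /existsP[r' /eqP E].
    have rr' : r' = r by apply: ls_inj; exact: (congr1 (fun a => tag a) E).
    by move: E; rewrite rr' => /eqP; rewrite eq_Tagged eq_sym.
  rewrite leqn0 cards_eq0; apply/eqP/setP => j; rewrite !inE.
  apply/negbTE/existsP => -[r /eqP E]; case/codomP: nl; exists r.
  exact: esym (congr1 (fun a => tag a) E).
case: o => [a|] /=; last first.
  by rewrite leqn0 cards_eq0; apply/eqP/setP => j; rewrite !inE.
apply/card_le1_eqP => j1 j2; rewrite !inE => /eqP/Some_inj -> /eqP/Some_inj/eqP.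
by rewrite eq_Tagged => /eqP.
Qed.

Lemma index_kept r : i r \in kept_set (ls r).
Proof. by rewrite inE; apply/orP; left; apply/existsP; exists r. Qed.

Definition kept_index : Defs.index (fun l => #|kept_set l|) ls :=
  fun r => enum_rank_in (index_kept r) (i r).

Definition kept_emb l : 'I_#|kept_set l| -> 'I_(n l) := @enum_val _ _.

Lemma kept_emb_inj l : injective (@kept_emb l).
Proof. exact: enum_val_inj. Qed.

Lemma kept_indexK r : kept_emb (kept_index r) = i r.
Proof. exact: enum_rankK_in (index_kept r). Qed.

Lemma kept_o : kept kept_emb o.
Proof.
rewrite /kept; case E: o => [[l j]|] //.
have jl : j \in kept_set l by rewrite inE E eqxx orbT.
apply/codomP; exists (existT _ l (enum_rank_in jl j)).
by rewrite /emb /= /kept_emb enum_rankK_in.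
Qed.

End Kept.

(** Pigeonhole: if each label [o] were absent from some [m o] on, the label at the maximum of these
    bounds would be absent there. *)
Lemma frequent_label (n : 'I_k -> nat) (lab : nat -> option (instance n)) :
  exists o, forall m, exists2 v, (m <= v)%N & lab v = o.
Proof.
apply: contrapT => none.
have /choice[m mP] o : exists m, forall v, (m <= v)%N -> lab v <> o.
  apply: contrapT => often; apply: none; exists o => m.
  apply: contrapT => late; apply: often; exists m => v mv labv.
  by apply: late; exists v.
by apply: (mP (lab (\max_o m o)) (\max_o m o)) => //; apply: leq_bigmax.
Qed.

(** * Transfer of runs and of quantified formulas *)

Definition computation_kind (Q : quantifier) n : computation n -> Prop :=
  match Q with
  | A | E => @maximal R k S U n
  | A_inf | E_inf => @infinite R k S U n
  | A_fin | E_fin => @finite R k S U n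
  end.

Lemma kept_cutoff (Q : quantifier) n (i : Defs.index n ls) o l :
  injective ls -> (if Q is (A_fin | E_fin) then o = None else True) ->
  (#|kept_set i o l| <= cutoff U ls Q l)%N.
Proof.
move=> ls_inj oP; apply: leq_trans (card_kept_set i o l ls_inj) _.
(* The initial state gives [2 * template_size (U l) >= 2], which leaves room for the extra instance
   in the [A] and [E] cutoffs. *)
have S_gt0 : (0 < template_size (U l))%N by apply/card_gt0P; exists (initial (U l)).
case: Q oP => [||->||| ->] /=; case: (l \in codom ls); rewrite ?addn0 //;
  case: (o != None) => //=; lia.
Qed.

Lemma shrink_computation (Q : quantifier) n (i : Defs.index n ls) x :
  injective ls -> timed_computation (init_config R U n) x ->
  computation_kind Q x ->
  exists o, (forall l, #|kept_set i o l| <= cutoff U ls Q l)%N /\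
  exists y, [/\ timed_computation (init_config R U _) y, computation_kind Q y &
    same_path i (kept_index i o) (spath x) (spath y)].
Proof.
move=> ls_inj xC xQ.
have [x0 t0 vc0 xP] := (timed_computationP _ x).1 xC.
have /choice[lab labP] v : exists o, has_step x v ->
    step_by o (cfg x v) (time x v) (cfg x v.+1) (time x v.+1).
  by have [/xP[_ [o]]|] := boolP (has_step x v); [exists o | exists None].
have [o often] := frequent_label lab.
(* Finite runs need no recurring label; dropping the extra instance brings the bound down to 1. *)
pose o' := if Q is (A_fin | E_fin) then None else o.
have [y [yC ypath yinf yfin]] := project_computation (@kept_emb_inj n i o') xC labP.
have same : same_path i (kept_index i o') (spath x) (spath y).
  have agree c r : state c (inst n (ls r) (i r)) =
      state (proj (@kept_emb n i o') c) (inst _ (ls r) (kept_index i o' r)).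
    by rewrite /= /emb /= kept_indexK.
  move=> s; split=> [c xc|c' /ypath[c xc ->]]; last by exists c.
  by exists (proj (@kept_emb n i o') c) => //; apply/ypath; exists c.
exists o'; split; first by move=> l; apply: kept_cutoff => //; rewrite /o'; case: (Q).
have inf : (if Q is (A_fin | E_fin) then False else True) -> infinite x -> infinite y.
  move=> Qinf xinf; apply: yinf => // m; have [v mv labv] := often m.
  exists v => //; rewrite labv (_ : o = o'); first exact: kept_o.
  by rewrite /o'; case: (Q) Qinf.
(* A deadlock need not survive the removal of instances, as guards get weaker; the finite projection
   is extended to a maximal run instead. *)
have max : (if Q is (A | E) then True else False) -> maximal x -> exists y',
    [/\ timed_computation (init_config R U _) y', maximal y' & spath y' = spath y].
  move=> Qmax [xinf|[m lenx _]].
    by exists y; split=> //; left; apply: inf => //; case: (Q) Qmax.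
  by apply: finite_extends_to_maximal yC _; apply: yfin; exists m.
case: (Q) xQ inf max => /= xQ inf max.
all: try by exists y; split=> //; [exact: inf | exact: yfin].
all: try by exists y; split=> //; exact: inf.
all: try by exists y; split=> //; exact: yfin.
all: by have [y' [? ? pathE]] := max I xQ; exists y'; rewrite pathE.
Qed.

Lemma grow_computation (Q : quantifier) n (i : Defs.index n ls) o y :
  timed_computation (init_config R U _) y -> computation_kind Q y ->
  exists x, [/\ timed_computation (init_config R U n) x, computation_kind Q x &
    same_path i (kept_index i o) (spath x) (spath y)].
Proof.
move=> yC yQ; have e_inj := @kept_emb_inj n i o.
pose x := lift_computation (@kept_emb n i o) y.
have xC : timed_computation (init_config R U n) x by exact: lift_timed_computation.
have same : same_path i (kept_index i o) (spath x) (spath y).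
  have agree c s r : state (lift (@kept_emb n i o) c s) (inst n (ls r) (i r)) =
      state c (inst _ (ls r) (kept_index i o r)).
    have [<- _] := lift_emb e_inj c s (inst _ (ls r) (kept_index i o r)).
    by rewrite /emb /= kept_indexK.
  move=> s; split=> [c /lift_spath[c' yc' ->]|c' yc']; first by exists c'.
  by exists (lift (@kept_emb n i o) c' s) => //; apply/lift_spath; exists c'.
(* Added instances may be able to move where [y] is deadlocked, so the lifted finite run is extended
   as well. *)
have max : maximal y -> exists x',
    [/\ timed_computation (init_config R U n) x', maximal x' & spath x' = spath x].
  move=> [yinf|[m leny _]]; first by exists x; split=> //; left.
  by apply: finite_extends_to_maximal xC _; exists m.
case: Q yQ => /= yQ; try by exists x.
all: by have [x' [? ? pathE]] := max yQ; exists x'; rewrite pathE.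
Qed.

Lemma state_satE (Q : quantifier) n (i : Defs.index n ls) (Phi : imtl S ls) c :
  state_sat Q (c : config n) i Phi =
  if Q is (E | E_inf | E_fin)
  then ~ all_paths (@computation_kind Q n) c i (Not Phi)
  else all_paths (@computation_kind Q n) c i Phi.
Proof. by case: Q. Qed.

Lemma all_paths_shrink (Q : quantifier) n (i : Defs.index n ls) (Phi : imtl S ls) :
  injective ls ->
  (forall o, (forall l, #|kept_set i o l| <= cutoff U ls Q l)%N ->
     all_paths (@computation_kind Q _) (init_config R U _) (kept_index i o) Phi) ->
  all_paths (@computation_kind Q n) (init_config R U n) i Phi.
Proof.
move=> ls_inj small x xC xQ x0.
have [o [bound [y [yC yQ same]]]] := shrink_computation i ls_inj xC xQ.
apply/(same_path_sat Phi same)/(small o bound y yC yQ).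
exact/(same_path_defined 0 same).
Qed.

Lemma all_paths_grow (Q : quantifier) n (i : Defs.index n ls) o (Phi : imtl S ls) :
  all_paths (@computation_kind Q n) (init_config R U n) i Phi ->
  all_paths (@computation_kind Q _) (init_config R U _) (kept_index i o) Phi.
Proof.
move=> large y yC yQ y0; have [x [xC xQ same]] := grow_computation yC yQ.
apply/(same_path_sat Phi same)/(large x xC xQ).
exact/(same_path_defined 0 same).
Qed.

End Formulas.
End Networks.

Theorem theorem2 (R : realType) (k : nat) (S : 'I_k -> finType)
  (U : forall l : 'I_k, template S l)
  (h : nat) (ls : 'I_h -> 'I_k) (ls_inj : injective ls)
  (Q : quantifier) (Phi : imtl S ls) :
  (forall n : 'I_k -> nat, network_models R U n Q Phi) <->
  (forall d : 'I_k -> nat,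
     (forall l : 'I_k, d l <= cutoff U ls Q l) -> network_models R U d Q Phi).
Proof.
split=> [all_n d _|small n i]; first exact: all_n.
have small_o o (bound : forall l, #|kept_set i o l| <= cutoff U ls Q l) :
    state_sat Q (init_config R U _) (kept_index i o) Phi.
  exact: (small (fun l => #|kept_set i o l|)).
(* The [E] quantifiers negate a universal one: if all large runs satisfied [Not Phi], so would all
   small runs. Here the named instances suffice, hence the label [None]. *)
have grow := @all_paths_grow R k S U h ls Q n i None (Not Phi).
have bound0 l := @kept_cutoff k S U h ls Q n i None l ls_inj.
have shrink := @all_paths_shrink R k S U h ls Q n i Phi ls_inj.
rewrite state_satE; case: Q small_o grow bound0 shrink {small} => /=
  small grow bound0 shrink; try exact: shrink.
all: by move=> /grow; apply: small => l; apply: bound0.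
Qed.
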